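(* Let $D=([n],A)$ be an acyclic digraph with $n\ge 3$. Then $$\Psi(D,x)-\Omega(\bar D,x)=\sum_{i=0}^{n-3}d_i\binom{x+i}{n-2},$$ where $d_0,d_1,\dots,d_{n-3}$ are non-negative integers. Furthermore, $d_i=0$ for every $i=0,1,\dots,n-3$ if and only if $\mathcal{W}(D)=\emptyset$.
   Context: For distinct vertices $a,b$, write $a\prec_D b$ if $D$ has a directed path from $a$ to $b$, and $a\not\approx_D b$ if neither $a\prec_D b$ nor $b\prec_D a$. $\mathcal{W}(D)$ is the set of $3$-element subsets $\{a,b,c\}\subseteq[n]$ with $a<b<c$ such that $(c,a)\in A$, $a\not\approx_D b$ and $c\not\approx_D b$. $\mathcal{OP}(D)$ is the set of orderings $(u_1,\dots,u_n)$ of $[n]$ such that $(u_i,u_j)\in A$ implies $i<j$. $\delta_D(a,b)=1$ if $a<b$ or $(a,b)\in A$, else $0$; $\delta_D((a_1,\dots,a_n))=\sum_{i=1}^{n-1}\delta_D(a_i,a_{i+1})$. $\Psi(D,x)=\sum_{\pi\in\mathcal{OP}(D)}\binom{x+\delta_D(\pi)}{n}$, where $\binom{x+k}{m}=(x+k)(x+k-1)\cdots(x+k-m+1)/m!$. $\bar D$ is the poset which is the reflexive transitive closure of $D$, and $\Omega(P,x)$ is the order polynomial of a poset $P$ (at a positive integer $m$ it counts maps $\sigma:P\to[m]$ with $u\preceq v\Rightarrow\sigma(u)\le\sigma(v)$). *)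

(* Defs.v *)
From mathcomp Require Import all_boot all_order all_algebra.

Set Implicit Arguments.
Unset Strict Implicit.
Unset Printing Implicit Defensive.

Import Order.TTheory GRing.Theory Num.Theory.

(* A digraph ([n], A) is given by its arc relation A : rel 'I_n; the ordinal k
   stands for the vertex k + 1, which preserves the order on vertices. *)

(* A one-element cycle is a loop and a two-element cycle a pair of opposite
   arcs; both are excluded. *)
Definition acyclic (n : nat) (A : rel 'I_n) : Prop :=
  forall p : seq 'I_n, ucycle A p -> p = [::].

Definition prec (n : nat) (A : rel 'I_n) (a b : 'I_n) : bool :=
  (a != b) && connect A a b.

Definition incomp (n : nat) (A : rel 'I_n) (a b : 'I_n) : bool :=
  ~~ prec A a b && ~~ prec A b a.

Definition W (n : nat) (A : rel 'I_n) : {set {set 'I_n}} :=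
  [set S : {set 'I_n} | [exists a : 'I_n, exists b : 'I_n, exists c : 'I_n,
    [&& S == [set a; b; c], a < b, b < c, A c a, incomp A a b & incomp A c b]]].

Definition OP (n : nat) (A : rel 'I_n) : {set n.-tuple 'I_n} :=
  [set u : n.-tuple 'I_n | uniq u &&
    [forall i : 'I_n, forall j : 'I_n, A (tnth u i) (tnth u j) ==> (i < j)]].

Definition delta (n : nat) (A : rel 'I_n) (a b : 'I_n) : nat :=
  if (a < b) || A a b then 1 else 0.

(* The inner sum has the single term j = i + 1, and none when i is the last
   index. *)
Definition delta_seq (n : nat) (A : rel 'I_n) (u : n.-tuple 'I_n) : nat :=
  \sum_(i < n) \sum_(j < n | j == i.+1 :> nat) delta A (tnth u i) (tnth u j).

Definition bar (n : nat) (A : rel 'I_n) : rel 'I_n := connect A.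

Lemma acyclic_bar_porder (n : nat) (A : rel 'I_n) : acyclic A ->
  [/\ reflexive (bar A), antisymmetric (bar A) & transitive (bar A)].
Proof.
move=> acA; split; first exact: connect0; last exact: connect_trans.
move=> x y /andP[/connectP[[|z p] /= pA ey] yx]; first by rewrite ey.
case/andP: pA => Axz pA.
have zx : connect A z x by apply: connect_trans yx; apply/connectP; exists p.
case/connectP: zx => q0 /shortenP[q qA uq _] ex.
suff: z :: q = [::] by [].
by apply: acA; rewrite /ucycle /= rcons_path qA -ex Axz.
Qed.

Local Open Scope ring_scope.

(* The polynomial binom(x + k, m). *)
Definition xbinom (k m : nat) : {poly rat} :=
  (m`!%:R)^-1 *: \prod_(j < m) ('X + (k%:R - j%:R)%:P).

Lemma xbinomE (k m x : nat) : (xbinom k m).[x%:R] = 'C(x + k, m)%:R.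
Proof.
rewrite /xbinom hornerZ horner_prod.
under eq_bigr do rewrite hornerD hornerX hornerC addrA -natrD.
apply: (canLR (mulKf _)); first by rewrite pnatr_eq0 -lt0n fact_gt0.
rewrite mulrC -natrM bin_ffact.
elim: m => [|m IH]; first by rewrite big_ord0.
rewrite big_ord_recr /= IH ffactnSr natrM.
case: (leqP m (x + k)) => h; first by rewrite natrB.
by rewrite ffact_small // !mul0r.
Qed.

Definition Psi (n : nat) (A : rel 'I_n) : {poly rat} :=
  \sum_(u in OP A) xbinom (delta_seq A u) n.

(* Maps into [m], with 'I_m standing for [m]. *)
Definition order_preserving (T : finType) (le : rel T) (m : nat) :
    {set {ffun T -> 'I_m}} :=
  [set s : {ffun T -> 'I_m} |
    [forall u, forall v, le u v ==> (s u <= s v)%N]].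

Lemma card_order_preserving_onto (T : finType) (le : rel T) (m : nat)
    (S : {set 'I_m}) :
  #|[set s in order_preserving le m | s @: setT == S]| =
  #|[set s in order_preserving le #|S| | s @: setT == setT]|.
Proof.
pose h (i : 'I_#|S|) : 'I_m := enum_val i.
have hlt (i j : 'I_#|S|) : (i < j)%N -> (h i < h j)%N.
  move=> ij; have x0 : 'I_m := h i.
  have st : sorted ltn (map val (enum S)).
    apply: (@subseq_sorted _ _ ltn_trans _ (map val (enum 'I_m))).
      by apply: map_subseq; rewrite /enum_mem filter_predT filter_subseq.
    by rewrite val_enum_ord iota_ltn_sorted.
  have := @sorted_ltn_nth _ ltn ltn_trans 0%N _ st i j.
  rewrite !inE !size_map -!cardE !ltn_ord => /(_ isT isT ij).
  rewrite !(nth_map x0) -?cardE //.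
  by rewrite /h (enum_val_nth x0 i) (enum_val_nth x0 j).
have hle (i j : 'I_#|S|) : (h i <= h j)%N = (i <= j)%N.
  case: (leqP i j) => [|/hlt]; last by rewrite ltnNge => /negbTE.
  rewrite leq_eqVlt => /orP[/eqP e|/hlt/ltnW -> //].
  by rewrite (val_inj e : i = j) leqnn.
have hI : injective h by exact: enum_val_inj.
have hS : h @: setT = S.
  apply/setP => x; apply/imsetP/idP => [[i _ ->]|xS]; first exact: enum_valP.
  by exists (enum_rank_in xS x); rewrite // /h enum_rankK_in.
pose H (g : {ffun T -> 'I_#|S|}) : {ffun T -> 'I_m} := [ffun t => h (g t)].
have HI : injective H.
  by move=> f g /ffunP e; apply/ffunP => t; move: (e t); rewrite !ffunE => /hI.
rewrite -(card_imset _ HI); apply: eq_card => s; rewrite inE.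
apply/andP/imsetP => [[]|[g]].
  rewrite inE => /forallP sle /eqP sS.
  have sin t : s t \in S by rewrite -sS imset_f.
  pose g : {ffun T -> 'I_#|S|} := [ffun t => enum_rank_in (sin t) (s t)].
  have gs t : h (g t) = s t by rewrite ffunE /h enum_rankK_in.
  exists g; last by apply/ffunP => t; rewrite ffunE gs.
  rewrite !inE; apply/andP; split.
    apply/forallP => u; apply/forallP => v; rewrite -hle !gs.
    by have /forallP := sle u; apply.
  apply/eqP/setP => i; rewrite inE; apply/imsetP.
  have : h i \in s @: setT by rewrite sS enum_valP.
  by case/imsetP => t _ e; exists t => //; apply: hI; rewrite gs.
rewrite !inE => /andP[/forallP gle /eqP gT] ->; split.
  apply/forallP => u; apply/forallP => v; rewrite !ffunE hle.
  by have /forallP := gle u; apply.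
apply/eqP; rewrite -hS -gT -imset_comp.
by apply: eq_imset => t; rewrite ffunE.
Qed.

Lemma order_polynomial_exists (T : finType) (le : rel T) :
  {p : {poly rat} | forall m : nat, (0 < m)%N ->
    p.[m%:R] = #|order_preserving le m|%:R}.
Proof.
pose e k := #|[set s in order_preserving le k | s @: setT == setT]|.
exists (\sum_(k < #|T|.+1) (e k)%:R *: xbinom 0 k) => m _.
rewrite horner_sum -sum1_card.
rewrite (partition_big (fun s : {ffun T -> 'I_m} => s @: setT)
  (fun S : {set 'I_m} => #|S| < #|T|.+1)%N) /=; last first.
  by move=> s _; rewrite ltnS -cardsT leq_imset_card.
rewrite (eq_bigr (fun S : {set 'I_m} => e #|S|)); last first.
  move=> S _; rewrite -[e _]card_order_preserving_onto -sum1_card.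
  by apply: eq_bigl => s; rewrite !inE.
rewrite (partition_big (fun S : {set 'I_m} => inord #|S| : 'I_#|T|.+1) xpredT) //=.
rewrite natr_sum; apply: eq_bigr => k _.
rewrite hornerZ xbinomE addn0 (eq_bigr (fun=> e k)); last first.
  by move=> S /andP[ltS /eqP <-]; rewrite inordK.
rewrite sum_nat_const mulnC natrM; congr (_ * _%:R).
rewrite -[m in LHS]card_ord -card_draws.
apply: eq_card => S; rewrite inE unfold_in.
apply/eqP/andP => [e1|[lt /eqP <-]]; last by rewrite inordK.
by rewrite e1 ltn_ord inord_val.
Qed.

(* The polynomial is defined by its values at the positive integers, which
   determine it (order_polynomial_unique); the poset is given by its order
   relation le, which for le := bar A is a partial order when A is acyclic
   (acyclic_bar_porder). *)
Definition order_polynomial (T : finType) (le : rel T) : {poly rat} :=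
  sval (order_polynomial_exists le).

Lemma order_polynomialE (T : finType) (le : rel T) (m : nat) : (0 < m)%N ->
  (order_polynomial le).[m%:R] = #|order_preserving le m|%:R.
Proof. exact: (svalP (order_polynomial_exists le)). Qed.

Lemma order_polynomial_unique (T : finType) (le : rel T) (p : {poly rat}) :
  (forall m : nat, (0 < m)%N -> p.[m%:R] = #|order_preserving le m|%:R) ->
  p = order_polynomial le.
Proof.
move=> pE; apply/eqP; rewrite -subr_eq0; apply: contraT => nz.
pose q := p - order_polynomial le.
have := @max_poly_roots _ q [seq (i.+1)%:R | i <- iota 0 (size q)] nz.
rewrite size_map size_iota ltnn => -> //.
  apply/allP => _ /mapP[i _ ->].
  by rewrite rootE hornerD hornerN pE // order_polynomialE // subrr.
rewrite map_inj_uniq ?iota_uniq // => i j /eqP.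
by rewrite eqr_nat => /eqP [].
Qed.

(* Main.v *)
Require Import Defs.
From mathcomp Require Import all_boot all_order all_algebra.
From mathcomp Require Import ring zify.

(** Let [T x y] mean that [x] precedes [y] in the poset, or that they are
    incomparable and [x < y]; [T] is a tournament containing the poset, and on
    a linear extension [delta_D] counts the [T]-ascents.  Under the linear map
    ['X^k |-> binom(x + k, n)], [Psi] is the image of the ascent generating
    polynomial [\sum_pi 'X^(asc_T pi)], and [('X - 1)^2 * 'X^i] goes to
    [binom(x + i, n - 2)].  So it suffices to transform [T] into the tournament
    of a natural labelling, which gives the order polynomial, so that each step
    lowers the ascent polynomial by a multiple of [('X - 1)^2] with natural
    coefficients.  The vertices are moved to the end of the tournament one by
    one, by decreasing natural label.  When [v] is moved, the linear extensions
    are grouped by what remains after deleting [v]; summing over the positions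
    of [v], the change telescopes, and what is left is [('X - 1)^2] times a
    monomial for each position where [v] and its neighbours form a directed
    triangle.

    At [x = m] the image of the ascent polynomial counts pairs of a monotone
    map [f] to ['I_m] and a linear extension along which [f] increases weakly,
    and strictly at the [T]-descents.  Every [f] has such an extension.  It is
    unique if [T] is transitive, that is, if [W] is empty; a triangle
    [{a < b < c}] in [W] gives an [f] with two of them, with [b] placed before
    [c] or after [a]. *)

Set Implicit Arguments.
Unset Strict Implicit.
Unset Printing Implicit Defensive.

Import Order.TTheory GRing.Theory Num.Theory.

Local Open Scope ring_scope.

(** * Ascents, linear extensions and insertions of a letter into a word *)

Section Words.
Variable V : eqType.
Implicit Types (T lt : rel V) (s q : seq V) (v x y : V).

Fixpoint ascents T x s : nat :=
  if s is y :: s' then (T x y + ascents T y s')%N else 0%N.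

Definition asc T s : nat := if s is x :: s' then ascents T x s' else 0%N.

Definition lin_ext lt s : bool := pairwise (fun x y => ~~ lt y x) s.

Lemma lin_ext_cons lt x s :
  lin_ext lt (x :: s) = all (fun y => ~~ lt y x) s && lin_ext lt s.
Proof. by []. Qed.

Fixpoint insertions v s : seq (seq V) :=
  if s is b :: s' then (v :: s) :: [seq b :: q | q <- insertions v s']
  else [:: [:: v]].

Lemma mem_insertions v s q : v \notin s ->
  (q \in insertions v s) = (v \in q) && (rem v q == s).
Proof.
elim: s q => [|b s IH] q /=.
  rewrite inE; case: q => [|x q] //=; rewrite inE.
  by case: (eqVneq x v) => [->|xv]; rewrite ?eqxx eqseq_cons ?eqxx //= ?(negbTE xv) ?andbF.
rewrite !inE negb_or => /andP[vb vs].
case: q => [|x q]; first by rewrite /=; apply/mapP => -[].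
rewrite eqseq_cons /= inE; case: (eqVneq x v) => [->|xv] /=.
  case: eqP => //= _; apply/mapP => -[q' _ [e _]].
  by rewrite e eqxx in vb.
rewrite eqseq_cons; apply/mapP/idP.
  by case=> q' + [-> ->]; rewrite IH // => /andP[-> ->]; rewrite eqxx.
move=> /andP[vq /andP[/eqP -> qs]]; exists q => //.
by rewrite IH // vq.
Qed.

Lemma insertions_uniq v s : v \notin s -> uniq (insertions v s).
Proof.
elim: s => [|b s IH] //=; rewrite inE negb_or => /andP[vb vs].
rewrite map_inj_uniq ?IH // ?andbT; last by move=> ? ? [].
by apply/mapP => -[q _ [e]]; rewrite e eqxx in vb.
Qed.

Lemma perm_insertions v s q : q \in insertions v s -> perm_eq q (v :: s).
Proof.
elim: s q => [|b s IH] q /=; first by rewrite inE => /eqP ->.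
rewrite inE => /orP[/eqP -> //|/mapP[q' /IH pq ->]].
apply: (@perm_trans _ [:: b, v & s]); first by rewrite perm_cons.
by apply/permPl/(perm_catCA [:: b] [:: v] s).
Qed.

(** Deleting [v] recovers the word into which it was inserted, so no permutation arises twice. Sums
    over linear extensions can thus be grouped by what remains without [v]. *)
Lemma permutations_insertions v s : uniq (v :: s) ->
  perm_eq (permutations (v :: s))
          [seq q | p <- permutations s, q <- insertions v p].
Proof.
move=> /= /andP[vs us].
have vp p : p \in permutations s -> v \notin p.
  by rewrite mem_permutations => /perm_mem ->.
apply: uniq_perm.
- exact: permutations_uniq.
- apply: allpairs_uniq_dep; first exact: permutations_uniq.
    by move=> p /vp; apply: insertions_uniq.
  move=> _ _ /allpairsPdep[p [q [ps qp ->]]] /allpairsPdep[p' [q' [ps' qp' ->]]] /= e.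
  move: qp qp'; rewrite -e !mem_insertions ?vp //.
  by case/andP=> _ /eqP <- /andP[_ /eqP <-].
move=> q; rewrite mem_permutations; apply/idP/allpairsPdep.
  move=> pq; have vq : v \in q by rewrite (perm_mem pq) mem_head.
  have ps : rem v q \in permutations s.
    rewrite mem_permutations -(perm_cons v).
    by apply: perm_trans pq; rewrite perm_sym perm_to_rem.
  by exists (rem v q), q; rewrite ps mem_insertions ?vp // vq eqxx.
case=> p [q' [ps qp ->]]; apply: perm_trans (perm_insertions qp) _.
by rewrite perm_cons -mem_permutations.
Qed.

Lemma lin_ext_cons_insertions lt v b s q : q \in insertions v s ->
  lin_ext lt (b :: s) -> lin_ext lt (b :: q) = ~~ lt v b && lin_ext lt q.
Proof.
move=> /perm_insertions pq; rewrite !lin_ext_cons => /andP[abs _].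
by rewrite (perm_all _ pq) /= abs andbT.
Qed.

Lemma lin_ext_insertions lt v s q : q \in insertions v s ->
  lin_ext lt q -> lin_ext lt s.
Proof.
elim: s q => [|b s IH] q //=; rewrite inE => /orP[/eqP ->|/mapP[q' qs ->]].
  by rewrite lin_ext_cons => /andP[].
rewrite !lin_ext_cons => /andP[+ /(IH _ qs) ->].
by rewrite (perm_all _ (perm_insertions qs)) /= andbT => /andP[].
Qed.

End Words.

(** * Multiples of [('X - 1)^2] with natural coefficients *)

Definition nat_coefs (h : {poly rat}) : Prop := forall i, h`_i \is a Num.nat.

Lemma nat_coefs0 : nat_coefs 0.
Proof. by move=> i; rewrite coef0. Qed.

Lemma nat_coefsXn k : nat_coefs 'X^k.
Proof. by move=> i; rewrite coefXn natr_nat. Qed.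

Lemma nat_coefsD g h : nat_coefs g -> nat_coefs h -> nat_coefs (g + h).
Proof. by move=> gN hN i; rewrite coefD rpredD. Qed.

Lemma nat_coefsXnM k h : nat_coefs h -> nat_coefs ('X^k * h).
Proof. by move=> hN i; rewrite coefXnM; case: ifP. Qed.

Lemma nat_coefsXM h : nat_coefs h -> nat_coefs ('X * h).
Proof. exact: (@nat_coefsXnM 1). Qed.

#[local] Hint Resolve nat_coefs0 nat_coefsXn nat_coefsD nat_coefsXnM
  nat_coefsXM : core.

(** The coefficients of the quotient [h] become the integers d_i. *)
Definition sqr_multiple (p : {poly rat}) : Prop :=
  exists2 h : {poly rat}, nat_coefs h & p = ('X - 1) ^+ 2 * h.

Lemma sqr_multiple0 : sqr_multiple 0.
Proof. by exists 0; rewrite // mulr0. Qed.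

Lemma sqr_multipleD p q :
  sqr_multiple p -> sqr_multiple q -> sqr_multiple (p + q).
Proof. by move=> [g gN ->] [h hN ->]; exists (g + h); rewrite -?mulrDr; auto. Qed.

Lemma sqr_multipleXn k p : sqr_multiple p -> sqr_multiple ('X^k * p).
Proof. by move=> [h hN ->]; exists ('X^k * h); rewrite 1?mulrCA; auto. Qed.

(** * The effect on ascents of moving one vertex *)

Section InsertVertex.
(* [M] is the set of vertices moved before [v]; [T'] is [T] with [v] placed just
   before [M] and after all the other vertices. *)
Variables (V : eqType) (lt T T' : rel V) (v : V) (M : pred V).
Hypothesis T'T : forall x y, x != v -> y != v -> T' x y = T x y.
Hypothesis Tv : forall x, x != v -> T v x = ~~ T x v.
Hypothesis T'v : forall x, x != v -> T' v x = ~~ T' x v.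
Hypothesis T'M : forall x, x != v -> T' x v = ~~ M x.
Hypothesis TM : forall x, x != v -> M x -> T x v = false.
Hypothesis TMr : forall x y, x != v -> y != v -> ~~ M x -> M y -> T x y.
Hypothesis TMl : forall x y, x != v -> y != v -> ~~ M x -> M y -> ~~ T y x.
Hypothesis ltT : forall x, x != v -> lt x v -> T x v.
Hypothesis ltM : forall x, x != v -> lt v x -> M x.

Lemma ascents_eq a s : a != v -> v \notin s -> ascents T' a s = ascents T a s.
Proof.
elim: s a => [|b s IH] a //= av; rewrite inE negb_or eq_sym => /andP[bv vs].
by rewrite T'T // IH.
Qed.

(** The letter [a] stands before the word and [v] goes somewhere after it; keeping track of [a]
    makes a recursion on [s] possible. *)
Definition insertion_gap a s : {poly rat} :=
  \sum_(q <- insertions v s | lin_ext lt q)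
    ('X^(ascents T a q) - 'X^(ascents T' a q)).

Lemma insertion_gap_nil a :
  insertion_gap a [::] = 'X^(T a v) - 'X^(T' a v).
Proof. by rewrite /insertion_gap /= big_cons big_nil /= addr0 !addn0. Qed.

(** The first summand is the insertion between [a] and [b], legal if no letter of the word lies
    below [v]; the second collects the later positions, all illegal when [v] lies below [b]. *)
Lemma insertion_gap_cons a b s : a != v -> v \notin b :: s ->
  lin_ext lt (b :: s) ->
  insertion_gap a (b :: s) =
    (if all (fun x => ~~ lt x v) (b :: s) then
       'X^(ascents T b s) *
         ('X^(T a v + ~~ T b v) - 'X^(T' a v + ~~ T' b v)) else 0)
    + (if lt v b then 0 else 'X^(T a b) * insertion_gap b s).
Proof.
move=> av; rewrite inE negb_or eq_sym => /andP[bv vs] lbs.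
rewrite /insertion_gap [insertions _ _]/= big_cons big_map.
have -> : lin_ext lt [:: v, b & s] = all (fun x => ~~ lt x v) (b :: s).
  by rewrite lin_ext_cons lbs andbT.
have -> : \sum_(q <- insertions v s | lin_ext lt (b :: q))
     ('X^(ascents T a (b :: q)) - 'X^(ascents T' a (b :: q))) =
  (if lt v b then 0 else 'X^(T a b) * insertion_gap b s) :> {poly rat}.
  rewrite big_seq_cond.
  under eq_bigl => q do rewrite -(andb_id2l (fun h => esym (lin_ext_cons_insertions h lbs))).
  case: (lt v b) => /=; first by rewrite big_pred0 // => q; rewrite andbF.
  rewrite -big_seq_cond /insertion_gap mulr_sumr; apply: eq_bigr => q _.
  by rewrite T'T // !exprD mulrBr.
case: ifP => _; last by rewrite add0r.
congr (_ + _); rewrite /= Tv // T'v // ascents_eq // !addnA.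
by rewrite [RHS]mulrC mulrBl !exprD.
Qed.

(* Telescoping the contributions of the insertion positions leaves the
   boundary term in [T a v]; a position contributes a multiple of [('X - 1)^2]
   exactly when [v] lies on a directed triangle with its neighbours. *)
Lemma insertion_gap_no_pred a s : a != v -> v \notin s ->
  all (fun x => ~~ lt x v) s -> lin_ext lt s ->
  sqr_multiple (insertion_gap a s
    - ('X - 1) * 'X^(ascents T a s) * ((T a v)%:R - (T' a v)%:R)).
Proof.
elim: s a => [|b s IH] a av.
  move=> _ _ _; rewrite insertion_gap_nil /=.
  suff -> : 'X^(T a v) - 'X^(T' a v) -
    ('X - 1) * 'X^0 * ((T a v)%:R - (T' a v)%:R) = 0 :> {poly rat}.
    exact: sqr_multiple0.
  by case: (T a v); case: (T' a v); rewrite /= ?expr0 ?expr1; ring.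
move=> vbs nbs lbs; rewrite insertion_gap_cons // nbs.
move: vbs nbs (lbs); rewrite inE negb_or eq_sym => /andP[bv vs] /andP[nb ns].
rewrite lin_ext_cons => /andP[_ ls].
have [h hN hE] := IH b bv vs ns ls.
have {}hE := canRL (subrK _) hE.
set w := 'X^(ascents T b s) in hE *.
have wN : nat_coefs w by rewrite /w.
rewrite /= !exprD -/w; case: ifP => vb.
  have Mb := ltM bv vb; rewrite (TM bv Mb) (T'M bv) Mb /= addr0.
  (* Here [v] fits only between [a] and [b], and [b] is in [M]. If [a] is in [M] too, both relations
     agree on [(a, v)]; if not, [T a b] holds and the boundary term is the whole gap. *)
  suff : T a b || (T a v == T' a v).
    case/orP=> [->|/eqP ->]; last by rewrite !(subrr, mulr0, subr0); exact: sqr_multiple0.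
    suff -> : w * ('X^(T a v) * 'X^1 - 'X^(T' a v) * 'X^1) -
      ('X - 1) * ('X^1%N * w) * ((T a v)%:R - (T' a v)%:R) = 0 :> {poly rat}.
      exact: sqr_multiple0.
    by case: (T a v); case: (T' a v); rewrite /= ?expr0 ?expr1; ring.
  case: (boolP (M a)) => Ma; last by rewrite TMr.
  by rewrite (TM av Ma) (T'M av) Ma orbT.
rewrite hE; case: (boolP (M b)) => Mb.
  rewrite (TM bv Mb) (T'M bv) Mb /= subrr mulr0 addr0.
  case: (boolP (M a)) => Ma.
    rewrite (TM av Ma) (T'M av) Ma /= !subrr !mulr0 subr0 add0r.
    by exists ('X^(T a b) * h); [auto|ring].
  rewrite (TMr av bv Ma Mb) (T'M av) Ma /=; exists ('X * h); first by auto.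
  by case: (T a v); rewrite /= ?expr0 ?expr1; ring.
rewrite !T'M // Mb /=.
case: (boolP (M a)) => Ma.
  rewrite (TM av) // (negbTE (TMl bv av Mb Ma)) /=.
  exists h => //; rewrite ?subrr ?mulr0 ?subr0.
  by case: (T b v); rewrite /= ?expr0 ?expr1; ring.
(* The summand [w] occurs in the two cases where [a], [v] and [b] form a directed triangle. *)
case: (T a v); case: (T b v); case: (T a b); rewrite /= ?expr0 ?expr1;
  [exists ('X * h)|exists h|exists ('X * h)|exists (w + h)|
   exists (w + 'X * h)|exists h|exists ('X * h)|exists h];
  auto; ring.
Qed.

(** If no letter of [s] lies below [v], the boundary term vanishes by hypothesis. Otherwise [v]
    cannot directly follow [a], and the claim passes to the tail; a letter below [v] is placed
    before [v] by both relations, so no boundary term arises from it. *)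
Lemma insertion_gap_pred a s : a != v -> v \notin s -> lin_ext lt s ->
  (T a v == T' a v) || has (fun x => lt x v) s ->
  sqr_multiple (insertion_gap a s).
Proof.
elim: s a => [|b s IH] a av.
  move=> _ _; rewrite orbF => /eqP e.
  by rewrite insertion_gap_nil e subrr; exact: sqr_multiple0.
move=> vbs lbs; case: (boolP (all (fun x => ~~ lt x v) (b :: s))) => nbs.
  have nh : has (fun x => lt x v) (b :: s) = false.
    by apply/negbTE; rewrite -all_predC.
  rewrite nh orbF => /eqP e; have := insertion_gap_no_pred av vbs nbs lbs.
  by rewrite e subrr mulr0 subr0.
move=> _; rewrite insertion_gap_cons // (negbTE nbs) add0r.
case: ifP => _; first exact: sqr_multiple0.
apply: sqr_multipleXn.
move: vbs nbs lbs; rewrite inE negb_or eq_sym => /andP[bv vs].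
rewrite -has_predC /= negbK => hbs /andP[_ ls].
apply: IH => //; case/orP: hbs => [bltv|hs].
  rewrite T'M //; have Tbv := ltT bv bltv.
  by case: (boolP (M b)) => [/(TM bv)|]; rewrite Tbv.
by rewrite orbC (sub_has _ hs) // => x /=; rewrite negbK.
Qed.

(** When [v] can go both in front and further on, the front insertion contributes exactly the
    opposite of the boundary term left by the other positions. *)
Lemma sum_insertions_diff s : v \notin s -> lin_ext lt s ->
  sqr_multiple (\sum_(q <- insertions v s | lin_ext lt q)
    ('X^(asc T q) - 'X^(asc T' q))).
Proof.
case: s => [|b s].
  by move=> _ _; rewrite big_cons big_nil /= subrr addr0; exact: sqr_multiple0.
move=> vbs lbs; move: (vbs); rewrite inE negb_or eq_sym => /andP[bv vs].
rewrite [insertions _ _]/= big_cons big_map.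
have -> : lin_ext lt [:: v, b & s] = all (fun x => ~~ lt x v) (b :: s).
  by rewrite lin_ext_cons lbs andbT.
have -> : \sum_(q <- insertions v s | lin_ext lt (b :: q))
     ('X^(asc T (b :: q)) - 'X^(asc T' (b :: q))) =
  (if lt v b then 0 else insertion_gap b s) :> {poly rat}.
  rewrite big_seq_cond.
  under eq_bigl => q do rewrite -(andb_id2l (fun h => esym (lin_ext_cons_insertions h lbs))).
  case: (lt v b) => /=; first by rewrite big_pred0 // => q; rewrite andbF.
  by rewrite -big_seq_cond.
have ls : lin_ext lt s by move: lbs; rewrite lin_ext_cons => /andP[].
case: ifP => nbs; last first.
  case: ifP => _; first exact: sqr_multiple0.
  apply: insertion_gap_pred => //.
  move/negbT: nbs; rewrite -has_predC /= negbK => /orP[bltv|hs].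
    rewrite T'M //; have Tbv := ltT bv bltv.
    by case: (boolP (M b)) => [/(TM bv)|]; rewrite Tbv.
  by rewrite orbC (sub_has _ hs) // => x /=; rewrite negbK.
rewrite /= Tv // T'v // ascents_eq // !exprD.
case: ifP => vb.
  have Mb := ltM bv vb; rewrite TM // T'M // Mb subrr addr0.
  exact: sqr_multiple0.
have /andP[_ ns] := nbs.
have [h hN /(canRL (subrK _)) ->] := insertion_gap_no_pred bv vs ns ls.
exists h => //.
by case: (T b v); case: (T' b v); rewrite /= ?expr0 ?expr1; ring.
Qed.

End InsertVertex.

(** * Ascent polynomials of tournaments containing the order *)

Definition tournament (V : eqType) (lt T : rel V) : Prop :=
  (forall x y, x != y -> T y x = ~~ T x y) /\ subrel lt T.

Section AscentPolynomial.
Variables (V : finType) (lt : rel V).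
Implicit Types (T : rel V) (l : V -> nat).

Definition asc_poly T : {poly rat} :=
  \sum_(s <- permutations (enum V) | lin_ext lt s) 'X^(asc T s).

Lemma eq_ascents T T' a s : T =2 T' -> ascents T a s = ascents T' a s.
Proof. by move=> e; elim: s a => //= b s IH a; rewrite e IH. Qed.

Lemma eq_asc_poly T T' : T =2 T' -> asc_poly T = asc_poly T'.
Proof.
by move=> e; apply: eq_bigr => -[|a s] _ //=; rewrite (eq_ascents _ _ e).
Qed.

(** Permutations are grouped by the word [p] left without [v]; if [p] is not a linear extension,
    none of its insertions is. *)
Lemma asc_poly_step T T' v (M : pred V) :
  (forall x y, x != v -> y != v -> T' x y = T x y) ->
  (forall x, x != v -> T v x = ~~ T x v) ->
  (forall x, x != v -> T' v x = ~~ T' x v) ->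
  (forall x, x != v -> T' x v = ~~ M x) ->
  (forall x, x != v -> M x -> T x v = false) ->
  (forall x y, x != v -> y != v -> ~~ M x -> M y -> T x y) ->
  (forall x y, x != v -> y != v -> ~~ M x -> M y -> ~~ T y x) ->
  (forall x, x != v -> lt x v -> T x v) ->
  (forall x, x != v -> lt v x -> M x) ->
  sqr_multiple (asc_poly T - asc_poly T').
Proof.
move=> h1 h2 h3 h4 h5 h6 h7 h8 h9.
have pV : perm_eq (enum V) (v :: rem v (enum V)).
  by rewrite perm_to_rem // mem_enum.
have uV : uniq (v :: rem v (enum V)) by rewrite -(perm_uniq pV) enum_uniq.
have pp := perm_trans (perm_permutations pV) (permutations_insertions uV).
rewrite /asc_poly -sumrB (perm_big _ pp) /= big_mkcond big_allpairs_dep /= big_seq.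
apply: (big_ind sqr_multiple sqr_multiple0 sqr_multipleD) => p.
rewrite mem_permutations -big_mkcond => pm.
case: (boolP (lin_ext lt p)) => lp.
  apply: (@sum_insertions_diff _ lt T T' v M) => //.
  by move: uV => /= /andP[]; rewrite (perm_mem pm).
rewrite big_seq_cond big_pred0; first exact: sqr_multiple0.
by move=> q; apply/andP => -[/lin_ext_insertions h /h]; apply/negP.
Qed.

(** Vertices labelled [k] or more come last, in the order of their labels; the others keep [T].
    Lowering [k] to 0 leads from [T] to the order by labels. *)
Definition truncate_tournament T l k : rel V := fun x y =>
  if (k <= l x)%N || (k <= l y)%N then (l x < l y)%N else T x y.

Lemma truncate_tournamentP T l k : injective l ->
  (forall x y, lt x y -> (l x < l y)%N) -> tournament lt T ->
  tournament lt (truncate_tournament T l k).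
Proof.
move=> linj ltl [Tanti ltT]; split=> [x y xy|x y xy]; rewrite /truncate_tournament.
  rewrite orbC; case: ifP => _; last exact: Tanti.
  have : l x != l y by rewrite (inj_eq linj).
  by case: ltngtP.
by case: ifP => _; [apply: ltl | apply: ltT].
Qed.

Lemma asc_poly_tournament T l : injective l ->
  (forall x y, lt x y -> (l x < l y)%N) -> tournament lt T ->
  sqr_multiple (asc_poly T - asc_poly (fun x y => l x < l y)%N).
Proof.
move=> linj ltl TT.
pose B := (\max_x l x).+1.
have lB x : (l x < B)%N by rewrite ltnS leq_bigmax.
have -> : asc_poly T = asc_poly (truncate_tournament T l B).
  by apply: eq_asc_poly => x y; rewrite /truncate_tournament (ltn_geF (lB x)) (ltn_geF (lB y)).
have -> : asc_poly (fun x y => l x < l y)%N = asc_poly (truncate_tournament T l 0).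
  by apply: eq_asc_poly => x y; rewrite /truncate_tournament.
elim: B {lB} => [|k IH]; first by rewrite subrr; exact: sqr_multiple0.
rewrite -(subrKA (asc_poly (truncate_tournament T l k))).
apply: sqr_multipleD IH.
case: (pickP (fun v => l v == k)) => [v /eqP lv|nk]; last first.
  rewrite (@eq_asc_poly _ (truncate_tournament T l k)) ?subrr; first exact: sqr_multiple0.
  have {}nk x : (k < l x)%N = (k <= l x)%N.
    by rewrite ltn_neqAle eq_sym; have /= -> := nk x.
  by move=> x y; rewrite /truncate_tournament !nk.
have [Tk1 ltTk1] := truncate_tournamentP k.+1 linj ltl TT.
have [Tk _] := truncate_tournamentP k linj ltl TT.
have nk x : x != v -> l x != k by rewrite -lv (inj_eq linj).
(* The vertices already moved are those with a label above [k], the label of [v]. *)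
apply: (@asc_poly_step _ _ v (fun x => k < l x)%N).
- move=> x y /nk xk /nk yk; rewrite /truncate_tournament !(ltn_neqAle k).
  by rewrite ![k == _]eq_sym xk yk.
- by move=> x xv; rewrite Tk1.
- by move=> x xv; rewrite Tk.
- move=> x /nk; rewrite /truncate_tournament lv leqnn orbT.
  by case: ltngtP.
- move=> x _ kx; rewrite /truncate_tournament kx lv; apply/negbTE.
  by rewrite -leqNgt ltnW.
- move=> x y _ _; rewrite -leqNgt /truncate_tournament => xk ky.
  by rewrite ky orbT (leq_ltn_trans xk).
- move=> x y _ _; rewrite -leqNgt /truncate_tournament => xk ky.
  by rewrite ky -leqNgt ltnW // (leq_ltn_trans xk).
- by move=> x _; apply: ltTk1.
- by move=> x _ /ltl; rewrite lv.
Qed.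

End AscentPolynomial.

(** * Counting the maps that fit a fixed word *)

Section Counting.
Local Open Scope nat_scope.

Lemma card_tupleS (A : finType) n (P : pred (seq A)) :
  #|[set c : n.+1.-tuple A | P c]| = \sum_(a : A) #|[set c : n.-tuple A | P (a :: c)]|.
Proof.
rewrite -sum1_card.
rewrite (reindex (fun p : A * n.-tuple A => [tuple of p.1 :: p.2])) /=; last first.
  exists (fun c => (thead c, [tuple of behead c])) => [[a c] _|c _] /=.
    by rewrite theadE; congr (_, _); apply: val_inj.
  by rewrite [RHS]tuple_eta.
under [RHS]eq_bigr do rewrite -sum1_card.
rewrite pair_big_dep /=; apply: eq_bigl => p; by rewrite !inE.
Qed.

(** The hockey-stick identity; [d <= n] gives the base case, where ['C(d, n.+1)] vanishes. *)
Lemma sum_bin_diag m r d n : r <= m -> d <= n ->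
  \sum_(m - r <= i < m) 'C(m.-1 - i + d, n) = 'C(r + d, n.+1).
Proof.
move=> + dn; elim: r => [|r IH] rm; first by rewrite subn0 big_geq ?bin_small.
rewrite big_ltn; last by lia.
rewrite (_ : (m - r.+1).+1 = m - r) ?IH; [|by lia|by lia].
rewrite (_ : m.-1 - (m - r.+1) = r); last by lia.
by rewrite addSn binS addnC.
Qed.

Variables (V : finType).
Implicit Types (T lt : rel V) (s : seq V).

Lemma ascents_le T a s : ascents T a s <= size s.
Proof. by elim: s a => //= b s IH a; have := IH b; case: (T a b); lia. Qed.

Definition lex_rel T m : rel (V * 'I_m) :=
  fun p q => (p.2 < q.2) || ((p.2 == q.2) && T p.1 q.1).

Lemma card_path_tuples T m x (j : 'I_m) s :
  #|[set c : (size s).-tuple 'I_m | path (lex_rel T (m := m)) (x, j) (zip s c)]|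
  = 'C(m.-1 - j + ascents T x s, size s).
Proof.
elim: s x j => [|y s IH] x j.
  rewrite bin0 -[RHS](card_tuple 0 'I_m); apply: eq_card => c.
  by rewrite !inE (tuple0 c).
rewrite (card_tupleS _ (fun c => path (lex_rel T (m := m)) (x, j) (zip (y :: s) c))).
(* The number of values open to [y]: those from [j] on at an ascent, those beyond [j] at a
   descent. *)
pose r := m - j - ~~ T x y.
transitivity (\sum_(i < m | m - r <= i) 'C(m.-1 - i + ascents T y s, size s)).
  rewrite [RHS]big_mkcond /=; apply: eq_bigr => i _.
  have -> : (m - r <= i) = lex_rel T (x, j) (y, i).
    rewrite /lex_rel /= -val_eqE /= /r; have := ltn_ord j.
    by case: (T x y) => /=; lia.
  case: ifP => h; rewrite ?h.
    by rewrite -IH; apply: eq_card => c; rewrite !inE.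
  by apply/eqP; rewrite cards_eq0; apply/eqP/setP => c; rewrite !inE.
have rm : r <= m by rewrite /r; lia.
rewrite -(big_geq_mkord (m - r) m xpredT (fun i => 'C(m.-1 - i + ascents T y s, size s))).
rewrite sum_bin_diag ?ascents_le //.
by congr 'C(_, _); have := ltn_ord j; rewrite /r /=; case: (T x y) => /=; lia.
Qed.

Lemma card_sorted_zip T m s :
  #|[set c : (size s).-tuple 'I_m | sorted (lex_rel T (m := m)) (zip s c)]|
  = 'C(m + asc T s, size s).
Proof.
case: s => [|x s].
  rewrite bin0 -[RHS](card_tuple 0 'I_m); apply: eq_card => c.
  by rewrite !inE (tuple0 c).
rewrite (card_tupleS _ (fun c => sorted (lex_rel T (m := m)) (zip (x :: s) c))).
under eq_bigr do rewrite card_path_tuples.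
rewrite -(big_mkord xpredT (fun i => 'C(m.-1 - i + ascents T x s, size s))).
by have := sum_bin_diag (leqnn m) (ascents_le T x s); rewrite subnn => ->.
Qed.

Definition lex_fun T m (f : V -> 'I_m) : rel V :=
  fun x y => (f x < f y) || ((f x == f y) && T x y).

Lemma card_compatible T m s : perm_eq s (enum V) ->
  #|[set f : {ffun V -> 'I_m} | sorted (lex_fun T f) s]| = 'C(m + asc T s, #|V|).
Proof.
move=> ps; have sV : size s = #|V| by rewrite (perm_size ps) -cardE.
rewrite -sV -card_sorted_zip.
pose g (f : {ffun V -> 'I_m}) := map_tuple f (in_tuple s).
have ginj : injective g.
  move=> f f' /(congr1 val) /= /eq_in_map e; apply/ffunP => x; apply: e.
  by rewrite (perm_mem ps) mem_enum.
have gbij : bijective g.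
  by apply: inj_card_bij => //; rewrite card_ffun card_tuple card_ord sV.
rewrite -(on_card_preimset (onW_bij _ gbij)); apply: eq_card => f.
rewrite !inE /=; have -> : zip s (map f s) = [seq (x, f x) | x <- s].
  by elim: (s) => //= x t ->.
by rewrite sorted_map.
Qed.

End Counting.

(** * Insertion sort for a relation that may fail to be transitive *)

Section SortedInsertion.
Variable V : eqType.
Implicit Types (lt R : rel V) (s e : seq V) (x y : V).

Lemma pairwise_mem (r : rel V) s x y : pairwise r s ->
  x \in s -> y \in s -> x != y -> r x y || r y x.
Proof.
elim: s => //= b s IH /andP[/allP rb ps]; rewrite !inE.
case: (eqVneq x b) => [->|_] /=; case: (eqVneq y b) => [->|_] //=.
- by move=> _ /rb ->.
- by move=> /rb ->; rewrite orbT.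
exact: IH.
Qed.

Fixpoint rinsert R x s : seq V :=
  if s is b :: s' then if R x b then x :: s else b :: rinsert R x s'
  else [:: x].

Lemma rinsertP R x s : exists s1 s2,
  [/\ s = s1 ++ s2, rinsert R x s = s1 ++ x :: s2, all (fun y => ~~ R x y) s1
    & if s2 is b :: _ then R x b else true].
Proof.
elim: s => [|b s [s1 [s2 [-> e h1 h2]]]] /=; first by exists [::], [::].
case: ifP => xb; first by exists [::], (b :: s1 ++ s2).
by exists (b :: s1), s2; split; rewrite //= ?e ?xb.
Qed.

Lemma rinsert_path R x a s : {in s, forall b, R x b || R b x} ->
  R a x -> path R a s -> path R a (rinsert R x s).
Proof.
elim: s a => [|b s IH] a tot ax /=; first by rewrite ax.
case/andP=> ab pbs; case: ifP => xb /=; first by rewrite ax xb.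
rewrite ab IH //; first by move=> c cs; rewrite tot // inE cs orbT.
by have := tot b (mem_head _ _); rewrite xb.
Qed.

Lemma rinsert_sorted R x s : {in s, forall b, R x b || R b x} ->
  sorted R s -> sorted R (rinsert R x s).
Proof.
case: s => [|b s] //= tot pbs; case: ifP => xb /=; first by rewrite xb.
apply: rinsert_path => //; first by move=> c cs; rewrite tot // inE cs orbT.
by have := tot b (mem_head _ _); rewrite xb.
Qed.

Lemma lin_ext_mid lt x s1 s2 : lin_ext lt (s1 ++ s2) ->
  {in s1, forall y, ~~ lt x y} -> {in s2, forall y, ~~ lt y x} ->
  lin_ext lt (s1 ++ x :: s2).
Proof.
rewrite /lin_ext !pairwise_cat allrel_consr pairwise_cons.
by case/and3P=> -> -> -> /allP -> /allP ->.
Qed.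

(** Insertion sort, as for Hamiltonian paths in tournaments. Letters passed over are not
    [R]-successors of [x], hence not above it; no letter lies below [x], which heads the linear
    extension [x :: e]. *)
Lemma exists_sorted_lin_ext lt R e : subrel lt R ->
  (forall x y, x != y -> R x y || R y x) -> uniq e -> lin_ext lt e ->
  exists s, [/\ perm_eq s e, lin_ext lt s & sorted R s].
Proof.
move=> ltR tot; elim: e => [|x e IH]; first by exists [::].
rewrite lin_ext_cons => /= /andP[xe ue] /andP[/allP hx le].
have [s [pse ls ss]] := IH ue le.
have xs : x \notin s by rewrite (perm_mem pse).
exists (rinsert R x s); split.
- have [s1 [s2 [e1 -> _ _]]] := rinsertP R x s.
  by rewrite perm_catC /= perm_cons perm_catC -e1.
- have [s1 [s2 [e1 -> h1 _]]] := rinsertP R x s.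
  apply: lin_ext_mid; rewrite -?e1 //.
    by move=> y /(allP h1); apply/contra/ltR.
  by move=> y ys; apply: hx; rewrite -(perm_mem pse) e1 mem_cat ys orbT.
- apply: rinsert_sorted => // b bs; apply: tot.
  by apply: contraNneq xs => ->.
Qed.

End SortedInsertion.

(** * Compatible pairs of a map and a linear extension *)

Section Compatible.
Local Open Scope nat_scope.
Variables (V : finType) (lt T : rel V) (l : V -> nat).
Hypothesis lt_l : forall x y, lt x y -> l x < l y.
Hypothesis Ttour : tournament lt T.
Hypothesis Tirr : irreflexive T.

Lemma lt_neq x y : lt x y -> x != y.
Proof. by move=> /lt_l; apply: contraTneq => ->; rewrite ltnn. Qed.

Lemma exists_lin_ext : exists2 e, perm_eq e (enum V) & lin_ext lt e.
Proof.
pose r : rel V := relpre l leq.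
exists (sort r (enum V)); first by rewrite perm_sort.
apply: (@sub_pairwise _ r); last first.
  rewrite -sorted_pairwise; last by move=> y x z; apply: leq_trans.
  by apply: sort_sorted => x y; apply: leq_total.
by move=> x y; rewrite /r /= leqNgt; apply: contra; apply: lt_l.
Qed.

Section Maps.
Variable m : nat.
Implicit Type f : {ffun V -> 'I_m}.

Definition compatible f s : bool := lin_ext lt s && sorted (lex_fun T f) s.

Definition monotone f := [forall x, forall y, lt x y ==> (f x <= f y)].

Lemma monotoneP f : reflect (forall x y, lt x y -> f x <= f y) (monotone f).
Proof.
apply: (iffP forallP) => h x; last first.
  by apply/forallP => y; apply/implyP/h.
by move=> y; have /forallP/(_ y)/implyP := h x.
Qed.

Lemma lex_fun_le f x y : lex_fun T f x y -> f x <= f y.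
Proof. by case/orP=> [/ltnW //|/andP[/eqP -> _]]. Qed.

Lemma lex_fun_total f x y : x != y -> lex_fun T f x y || lex_fun T f y x.
Proof.
move=> xy; rewrite /lex_fun (Ttour.1 x y xy) eq_sym -val_eqE.
by case: ltngtP => //= _; case: (T x y).
Qed.

Lemma lt_lex_fun f x y : monotone f -> lt x y -> lex_fun T f x y.
Proof.
move/monotoneP=> mf xy; rewrite /lex_fun (Ttour.2 _ _ xy) andbT.
by have := mf _ _ xy; rewrite leq_eqVlt val_eqE orbC.
Qed.

Lemma lex_sorted_pairwise f s : sorted (lex_fun T f) s ->
  pairwise (fun x y => f x <= f y) s.
Proof.
move=> ss; rewrite -sorted_pairwise; last by move=> y x z; apply: leq_trans.
apply: sub_sorted ss; exact: lex_fun_le.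
Qed.

Lemma compatible_monotone f s : perm_eq s (enum V) -> compatible f s ->
  monotone f.
Proof.
move=> ps /andP[ls /lex_sorted_pairwise ss]; apply/monotoneP => x y xy.
have sV z : z \in s by rewrite (perm_mem ps) mem_enum.
have := pairwise_relI (fun x y => ~~ lt y x) (fun x y => f x <= f y) s.
rewrite ss [pairwise _ s in RHS]ls => /pairwise_mem /(_ (sV x) (sV y) (lt_neq xy)).
by rewrite /= xy /= orbF => /andP[].
Qed.

Lemma exists_compatible f : monotone f ->
  exists2 s, perm_eq s (enum V) & compatible f s.
Proof.
move=> mf; have [e pe le] := exists_lin_ext.
have ue : uniq e by rewrite (perm_uniq pe) enum_uniq.
have [s [pse ls ss]] := exists_sorted_lin_ext (fun x y => lt_lex_fun mf)
  (lex_fun_total f) ue le.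
by exists s; [apply: perm_trans pe | apply/andP].
Qed.

(** A transitive [T] makes [lex_fun T f] a strict order, and a word sorted by a strict order is
    determined by its letters. *)
Lemma compatible_uniq f s s' : transitive T -> perm_eq s (enum V) ->
  perm_eq s' (enum V) -> compatible f s -> compatible f s' -> s = s'.
Proof.
move=> Ttr ps ps' /andP[_ ss] /andP[_ ss'].
apply: (@irr_sorted_eq _ (lex_fun T f)) => //.
- move=> y x z /orP[xy|/andP[/eqP xy Txy]] /orP[yz|/andP[/eqP yz Tyz]].
  + by rewrite /lex_fun (ltn_trans xy yz).
  + by rewrite /lex_fun -yz xy.
  + by rewrite /lex_fun xy yz.
  + by rewrite /lex_fun xy yz eqxx (Ttr _ _ _ Txy Tyz) orbT.
- by move=> x; rewrite /lex_fun ltnn Tirr andbF.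
- by apply: perm_mem; apply: perm_trans ps _; rewrite perm_sym.
Qed.

(* The vertex [b] fits both before [c] and after [a]. *)
Lemma two_compatible f a b c : monotone f -> lt c a -> T b c -> T a b ->
  f a = f b -> f c = f b -> b != a -> b != c ->
  (forall u, f u = f b -> ~~ lt u b && ~~ lt b u) ->
  exists s s', [/\ perm_eq s (enum V), perm_eq s' (enum V),
    compatible f s, compatible f s' & s != s'].
Proof.
move=> mf ca Tbc Tab fa fc ba bc inc; set R := lex_fun T f.
have /monotoneP mfP := mf.
have [e pe le] := exists_lin_ext.
have ue : uniq e by rewrite (perm_uniq pe) enum_uniq.
have eV z : z \in e by rewrite (perm_mem pe) mem_enum.
(* A sorted linear extension of the vertices other than [b], into which [b] is inserted in two
   ways. *)
have [s [ps ls ss]] := exists_sorted_lin_ext (fun x y => lt_lex_fun mf)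
  (lex_fun_total f) (rem_uniq b ue) (subseq_pairwise (rem_subseq b e) le).
have sV z : (z \in s) = (z != b).
  by rewrite (perm_mem ps) mem_rem_uniq // !inE eV andbT.
have bs : b \notin s by rewrite sV eqxx.
have pbs : perm_eq (b :: s) (enum V).
  apply: perm_trans pe; rewrite perm_sym; apply: perm_trans (perm_to_rem (eV b)) _.
  by rewrite perm_cons perm_sym.
have tot : {in s, forall x, R b x || R x b}.
  by move=> x; rewrite sV eq_sym; apply: lex_fun_total.
have Rbc : R b c by rewrite /R /lex_fun fc eqxx Tbc orbT.
have Rab : R a b by rewrite /R /lex_fun fa eqxx Tab orbT.
have as_ : a \in s by rewrite sV eq_sym.
have cs : c \in s by rewrite sV eq_sym.
have mono := lex_sorted_pairwise ss.
have [r1 [r2 [er er' hr1 hr2]]] := rinsertP R b s.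
have c1 : compatible f (rinsert R b s).
  apply/andP; split; last exact: rinsert_sorted.
  rewrite er'; apply: lin_ext_mid; rewrite -?er //.
    by move=> y /(allP hr1); apply/contra/lt_lex_fun.
  (* A letter [u] after the insertion point and below [b] has [f u <= f b] by monotonicity and
     [f b <= f u] by sortedness; [inc] forbids equality. *)
  move=> u ur2; apply/negP => ub; suff fu : f u = f b by have := inc u fu; rewrite ub.
  apply/val_inj/eqP; rewrite eqn_leq mfP //=.
  case: r2 {er'} er hr2 ur2 => // h r2 er Rbh.
  rewrite inE => /orP[/eqP ->|ur2]; first exact: lex_fun_le Rbh.
  apply: leq_trans (lex_fun_le Rbh) _; move: mono; rewrite er pairwise_cat /=.
  by case/and3P=> _ _ /andP[/allP/(_ _ ur2)].
have cr2 : c \notin r1 by apply/negP => /(allP hr1); rewrite Rbc.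
(* Split at [a]. As [c] lies below [a], it is in [p]; the second word inserts [b] into [q], hence
   after [c]. *)
case/splitPr: as_ er ps ls ss sV bs pbs tot cs mono er' c1 => p q er ps ls ss sV bs pbs tot cs mono er' c1.
have cp : c \in p.
  move: cs; rewrite mem_cat inE => /or3P[//|/eqP ac|cq].
    by have := lt_neq ca; rewrite ac eqxx.
  move: ls; rewrite /lin_ext pairwise_cat /=.
  by case/and4P=> _ _ /allP/(_ _ cq); rewrite ca.
have [q1 [q2 [eq eq' hq1 hq2]]] := rinsertP R b q.
have mono_pa u : u \in p ++ [:: a] -> f u <= f a.
  rewrite mem_cat inE => /orP[up|/eqP -> //].
  by move: mono; rewrite pairwise_cat allrel_consr => /andP[/andP[/allP/(_ _ up)]].
have mono_aq u : u \in q -> f a <= f u.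
  by move=> uq; move: mono; rewrite pairwise_cat /= => /and4P[_ _ /allP/(_ _ uq)].
have e2 : p ++ a :: rinsert R b q = (p ++ a :: q1) ++ b :: q2.
  by rewrite eq' -catA.
have c2 : compatible f (p ++ a :: rinsert R b q).
  apply/andP; split; last first.
    move: ss; rewrite !sorted_cat_cons => /andP[-> pq] /=.
    apply: rinsert_path => // x xq; apply: tot.
    by rewrite mem_cat inE xq !orbT.
  rewrite e2; apply: lin_ext_mid.
  - by rewrite -catA /= -eq.
  - move=> u; rewrite -cat1s catA mem_cat => /orP[upa|uq1]; last first.
      by have := allP hq1 u uq1; apply/contra/lt_lex_fun.
    apply/negP => bu; suff fu : f u = f b by have := inc u fu; rewrite bu andbF.
    by apply/val_inj/eqP; rewrite eqn_leq -{1}fa mono_pa //= mfP.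
  - move=> u uq2; apply/negP => ub; suff fu : f u = f b by have := inc u fu; rewrite ub.
    by apply/val_inj/eqP; rewrite eqn_leq mfP //= -fa mono_aq // eq mem_cat uq2 orbT.
exists (rinsert R b (p ++ a :: q)), (p ++ a :: rinsert R b q); split=> //.
- rewrite er' perm_catC /=; apply: perm_trans pbs.
  by rewrite perm_cons er perm_catC.
- rewrite e2 perm_catC /=; apply: perm_trans pbs.
  by rewrite perm_cons perm_catC -catA /= -eq.
have bp : b \notin p by move: bs; rewrite mem_cat negb_or => /andP[].
have br1 : b \notin r1 by move: bs; rewrite er mem_cat negb_or => /andP[].
(* The two words differ in the relative order of [b] and [c]. *)
apply/eqP => /(congr1 (fun t => index b t < index c t)).
rewrite er' !index_cat (negbTE br1) (negbTE cr2) /= eqxx (negbTE bc) (negbTE bp) cp addn0.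
rewrite addnS ltnS leq_addr => /esym; rewrite ltnNge => /negP; apply.
by rewrite ltnW // (leq_trans _ (leq_addr _ _)) // index_mem.
Qed.

Definition nb_compatible f : nat :=
  count (compatible f) (permutations (enum V)).

Lemma nb_compatible_gt0 f : (0 < nb_compatible f) = monotone f.
Proof.
rewrite -has_count; apply/hasP/idP => [[s]|mf].
  by rewrite mem_permutations; apply: compatible_monotone.
by have [s ps cs] := exists_compatible mf; exists s; rewrite // mem_permutations.
Qed.

Lemma nb_compatible_le1 f : transitive T -> nb_compatible f <= 1.
Proof.
move=> Ttr; rewrite /nb_compatible -size_filter.
set t := filter _ _.
have ut : uniq t by rewrite filter_uniq // permutations_uniq.
have et s s' : s \in t -> s' \in t -> s = s'.
  rewrite !mem_filter !mem_permutations => /andP[cs ps] /andP[cs' ps'].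
  exact: compatible_uniq Ttr ps ps' cs cs'.
case: t ut et => [|s [|s' t]] //= + et.
by rewrite (et s s') ?inE ?eqxx ?orbT.
Qed.

Lemma nb_compatible_gt1 f s s' : perm_eq s (enum V) -> perm_eq s' (enum V) ->
  compatible f s -> compatible f s' -> s != s' -> 1 < nb_compatible f.
Proof.
move=> ps ps' cs cs' ss'; rewrite /nb_compatible -size_filter.
apply: (@uniq_leq_size _ [:: s; s']); first by rewrite /= inE ss'.
by move=> t; rewrite !inE mem_filter mem_permutations => /orP[]/eqP ->; apply/andP.
Qed.

(** Double counting of compatible pairs: [card_compatible] counts the maps for a fixed word. *)
Lemma sum_bin_asc :
  \sum_(s <- permutations (enum V) | lin_ext lt s) 'C(m + asc T s, #|V|)
  = \sum_(f : {ffun V -> 'I_m}) nb_compatible f.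
Proof.
rewrite big_seq_cond.
transitivity (\sum_(s <- permutations (enum V) | lin_ext lt s)
   \sum_(f : {ffun V -> 'I_m}) sorted (lex_fun T f) s).
  rewrite [RHS]big_seq_cond; apply: eq_bigr => s /andP[].
  rewrite mem_permutations => ps _; rewrite -(card_compatible T m ps).
  by rewrite -sum1_card big_mkcond; apply: eq_bigr => f _; rewrite inE; case: sorted.
rewrite exchange_big; apply: eq_bigr => f _.
rewrite /nb_compatible -sum1_count big_mkcond [RHS]big_mkcond.
by apply: eq_bigr => s _; rewrite /compatible; case: lin_ext; case: sorted.
Qed.

(** A map has a compatible word exactly when it is monotone, so each monotone map is counted at
    least once, and equality means that none is counted twice. *)
Lemma sum_nb_compatible_ge :
  #|[set f | monotone f]| <= \sum_(f : {ffun V -> 'I_m}) nb_compatible f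
   ?= iff [forall f, nb_compatible f <= 1].
Proof.
rewrite -sum1_card big_mkcond /=.
have -> : [forall f, nb_compatible f <= 1] = [forall (f | true), nb_compatible f <= 1].
  by apply: eq_forallb.
apply: leqif_sum => f _; rewrite inE -nb_compatible_gt0.
by case: (nb_compatible f) => [|[|k]]; split.
Qed.

End Maps.
End Compatible.

(** * The passage from powers of ['X] to binomial polynomials *)

Lemma poly_eq_nat (p q : {poly rat}) :
  (forall m : nat, p.[m%:R] = q.[m%:R]) -> p = q.
Proof.
move=> pq; apply/eqP; rewrite -subr_eq0; apply: contraT => nz.
have := @max_poly_roots _ (p - q) [seq i%:R | i <- iota 0 (size (p - q))] nz.
rewrite size_map size_iota ltnn => -> //.
  by apply/allP => _ /mapP[i _ ->]; rewrite rootE hornerD hornerN pq subrr.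
rewrite map_inj_uniq ?iota_uniq // => i j /eqP.
by rewrite eqr_nat => /eqP.
Qed.

Lemma xbinomS k m : xbinom k.+1 m.+1 = xbinom k m.+1 + xbinom k m.
Proof.
apply: poly_eq_nat => x.
by rewrite hornerD !xbinomE addnS binS natrD.
Qed.

Section BinomialBasis.
Variable n : nat.

(** The linear map ['X^i |-> binom(x + i, n)]; coefficients from index [n] on are discarded, so it
    is applied under size bounds. *)
Definition binom_basis (p : {poly rat}) : {poly rat} :=
  \sum_(i < n) p`_i *: xbinom i n.

Lemma binom_basisB p q :
  binom_basis (p - q) = binom_basis p - binom_basis q.
Proof. by rewrite -sumrB; apply: eq_bigr => i _; rewrite coefB scalerBl. Qed.

Lemma binom_basis_sum (I : Type) (r : seq I) P (c : I -> rat) (F : I -> {poly rat}) :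
  binom_basis (\sum_(j <- r | P j) c j *: F j) =
  \sum_(j <- r | P j) c j *: binom_basis (F j).
Proof.
under [RHS]eq_bigr do rewrite scaler_sumr.
rewrite exchange_big; apply: eq_bigr => i _.
rewrite coef_sum scaler_suml; apply: eq_bigr => j _.
by rewrite coefZ; apply/esym/scalerA.
Qed.

Lemma binom_basisXn k : (k < n)%N -> binom_basis 'X^k = xbinom k n.
Proof.
move=> kn; rewrite /binom_basis (bigD1 (Ordinal kn)) //= coefXn eqxx scale1r.
rewrite big1 ?addr0 // => i; rewrite -val_eqE /= coefXn => /negbTE ->.
by rewrite scale0r.
Qed.

End BinomialBasis.

(** Multiplication by [('X - 1)^2] takes a second difference, and by Pascal's rule each difference
    lowers the lower index by one. *)
Lemma binom_basis_sqr n (h : {poly rat}) : (size h <= n)%N ->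
  binom_basis n.+2 (('X - 1) ^+ 2 * h) = binom_basis n h.
Proof.
move=> sh; have -> : ('X - 1) ^+ 2 * h =
    \sum_(j < n) h`_j *: (('X - 1) ^+ 2 * 'X^j).
  rewrite -{1}(coefK h) (poly_def (size h)) mulr_sumr.
  under eq_bigr do rewrite -scalerAr.
  rewrite (big_ord_widen n (fun i => h`_i *: (('X - 1) ^+ 2 * 'X^i))) //.
  rewrite big_mkcond /=; apply: eq_bigr => i _; case: ltnP => // hi.
  by rewrite nth_default ?scale0r.
rewrite binom_basis_sum; apply: eq_bigr => j _; congr (_ *: _).
have -> : ('X - 1) ^+ 2 * 'X^j = ('X^(j.+2) - 'X^(j.+1)) - ('X^(j.+1) - 'X^j) :> {poly rat}.
  by rewrite !exprS; ring.
have jn := ltn_ord j.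
rewrite !binom_basisB !binom_basisXn; try by lia.
by rewrite !xbinomS; ring.
Qed.

Lemma size_sqr_multiple (h : {poly rat}) n :
  (size (('X - 1) ^+ 2 * h : {poly rat})%R <= n.+2)%N -> (size h <= n)%N.
Proof.
have [->|h0] := eqVneq h 0; first by rewrite size_poly0.
have -> : ('X - 1) ^+ 2 = ('X - 1%:P) ^+ 2 :> {poly rat} by [].
rewrite size_monicM ?monic_exp ?monicXsubC // size_exp_XsubC.
by rewrite /= !addSn !ltnS add0n.
Qed.

(** * The image of the ascent polynomial *)

Section AscentBinomial.
Variables (V : finType) (lt : rel V).
Implicit Type T : rel V.
Hypothesis V_gt0 : (0 < #|V|)%N.

Lemma asc_lt T s : perm_eq s (enum V) -> (asc T s < #|V|)%N.
Proof.
move=> /perm_size; rewrite -cardE => es; move: V_gt0; rewrite -es.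
by case: s {es} => //= x s _; rewrite ltnS ascents_le.
Qed.

Lemma binom_basis_asc_poly T :
  binom_basis #|V| (asc_poly lt T) =
  \sum_(s <- permutations (enum V) | lin_ext lt s) xbinom (asc T s) #|V|.
Proof.
rewrite /asc_poly; under eq_bigr do rewrite -[_ ^+ _]scale1r.
rewrite binom_basis_sum big_seq_cond [RHS]big_seq_cond; apply: eq_bigr => s.
rewrite mem_permutations => /andP[ps _].
by rewrite scale1r binom_basisXn ?asc_lt.
Qed.

Lemma size_asc_poly T : (size (asc_poly lt T) <= #|V|)%N.
Proof.
rewrite /asc_poly big_seq_cond; apply: (big_ind (fun p : {poly rat} => size p <= #|V|)%N).
- by rewrite size_poly0.
- by move=> p q hp hq; apply: leq_trans (size_polyD _ _) _; rewrite geq_max hp.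
move=> s; rewrite mem_permutations => /andP[ps _].
by rewrite size_polyXn asc_lt.
Qed.

Lemma asc_poly_horner T m :
  (binom_basis #|V| (asc_poly lt T)).[m%:R] =
  (\sum_(f : {ffun V -> 'I_m}) nb_compatible lt T f)%:R.
Proof.
rewrite binom_basis_asc_poly horner_sum -sum_bin_asc natr_sum.
by apply: eq_bigr => s _; rewrite xbinomE.
Qed.

End AscentBinomial.

Lemma asc_nth (V : eqType) (R : rel V) (x0 : V) (s : seq V) :
  asc R s = (\sum_(i < (size s).-1) R (nth x0 s i) (nth x0 s i.+1))%N.
Proof.
case: s => [|x s]; first by rewrite big_ord0.
rewrite /=; elim: s x => [|y s IH] x /=; first by rewrite big_ord0.
by rewrite big_ord_recl /= IH.
Qed.

(** * The tournament of an acyclic digraph and a natural labelling *)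

Section Digraph.
Local Open Scope nat_scope.
Variables (n : nat) (A : rel 'I_n).
Hypothesis hA : acyclic A.
Implicit Types (a b c x y z : 'I_n) (s : seq 'I_n).

Lemma acyclic_irr x : A x x = false.
Proof.
apply/negP => Axx; have : ucycle A [:: x] by rewrite /ucycle /= Axx.
by move/hA.
Qed.

Lemma connect_anti x y : connect A x y -> connect A y x -> x = y.
Proof.
move=> xy yx; have [_ anti _] := acyclic_bar_porder hA.
by apply: anti; rewrite /bar xy.
Qed.

Lemma arc_prec x y : A x y -> prec A x y.
Proof.
move=> xy; rewrite /prec connect1 // andbT.
by apply: contraTneq xy => ->; rewrite acyclic_irr.
Qed.

Lemma prec_connect x y : prec A x y -> connect A x y.
Proof. by case/andP. Qed.

Lemma connect_prec x y : connect A x y = (x == y) || prec A x y.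
Proof. by rewrite /prec; case: eqVneq => [->|]; rewrite //= connect0. Qed.

Lemma prec_connect_trans x y z : prec A x y -> connect A y z -> prec A x z.
Proof.
case/andP=> xy cxy cyz; rewrite /prec (connect_trans cxy cyz) andbT.
by apply: contraNneq xy => xz; rewrite (connect_anti cxy) // xz.
Qed.

Lemma connect_prec_trans x y z : connect A x y -> prec A y z -> prec A x z.
Proof.
move=> cxy /andP[yz cyz]; rewrite /prec (connect_trans cxy cyz) andbT.
by apply: contraNneq yz => xz; rewrite (connect_anti cyz) // -xz.
Qed.

Lemma prec_anti x y : prec A x y -> ~~ prec A y x.
Proof.
move=> xy; apply/negP => /prec_connect yx.
by have := prec_connect_trans xy yx; rewrite /prec eqxx.
Qed.

Definition tour : rel 'I_n :=
  fun x y => prec A x y || (~~ prec A y x && (x < y)).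

Lemma tour_irr : irreflexive tour.
Proof. by move=> x; rewrite /tour /prec eqxx ltnn. Qed.

Lemma tourP : tournament (prec A) tour.
Proof.
split=> [x y xy|x y xy]; last by rewrite /tour xy.
rewrite /tour; case: (boolP (prec A x y)) => [/prec_anti/negbTE -> //|_].
case: (prec A y x) => //=; rewrite -leqNgt ltn_neqAle eq_sym.
by rewrite (_ : val x == val y = false) // (inj_eq val_inj); apply/negbTE.
Qed.

(** A two-part label in base [n]: the size of the down-set of [x] grows strictly along [prec], and
    the last digit [x] makes the label injective. *)
Definition topo_label x : nat := #|[set y | connect A y x]| * n + x.

Lemma topo_label_inj : injective topo_label.
Proof.
move=> x y /(congr1 (modn^~ n)); rewrite /topo_label !modnMDl !modn_small //.
exact: val_inj.
Qed.

Lemma topo_label_prec x y : prec A x y -> topo_label x < topo_label y.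
Proof.
move=> xy; have xn := ltn_ord x.
suff /proper_card : [set z | connect A z x] \proper [set z | connect A z y].
  rewrite -(leq_pmul2r (leq_trans (ltn0Sn x) xn)) mulSn => lt_card.
  apply: leq_trans (leq_addr _ _); apply: leq_trans lt_card.
  by rewrite /topo_label addnC ltn_add2r.
apply/properP; split.
  by apply/subsetP => z; rewrite !inE => /connect_trans; apply; apply: prec_connect.
exists y; rewrite !inE ?connect0 //; apply/negP => yx.
by have := prec_connect_trans xy yx; rewrite /prec eqxx.
Qed.

(** * Orderings of the digraph as linear extensions of its poset *)

Lemma perm_enum_ord s : uniq s -> size s = n -> perm_eq s (enum 'I_n).
Proof.
move=> us sn; apply: uniq_perm => //; first exact: enum_uniq.
have sub : {subset s <= enum 'I_n} by move=> x _; rewrite mem_enum.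
by have [] := uniq_min_size us sub; rewrite // sn size_enum_ord.
Qed.

(** [OP] constrains arcs only; positions increase along an arc, hence along directed paths. *)
Lemma OP_lin_ext (u : n.-tuple 'I_n) :
  (u \in OP A) = uniq u && lin_ext (prec A) u.
Proof.
rewrite inE; apply: andb_id2l => uu.
have uV x : x \in tval u.
  by rewrite (perm_mem (perm_enum_ord uu (size_tuple u))) mem_enum.
apply/forallP/idP => [h|ls i].
  have Aidx x y : A x y -> index x u < index y u.
    have /tnthP[i ->] := uV x; have /tnthP[j ->] := uV y.
    move=> Aij; have /forallP/(_ j)/implyP/(_ Aij) := h i.
    have x0 : 'I_n := i.
    by rewrite !(tnth_nth x0) !index_uniq ?size_tuple.
  have cidx x y : connect A x y -> index x u <= index y u.
    case/connectP=> p + ->; elim: p x => //= z p IH x /andP[/Aidx xz /IH].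
    exact/leq_trans/ltnW.
  case: (tval u) uu cidx {h uV Aidx} => // x0 s us cidx.
  apply/(pairwiseP x0) => i j; rewrite !inE => si sj ij; apply/negP.
  by move=> /prec_connect/cidx; rewrite !index_uniq // leqNgt ij.
apply/forallP => j; apply/implyP => /arc_prec Aij; rewrite ltnNge; apply/negP.
rewrite leq_eqVlt val_eqE => /orP[/eqP ij|ji].
  by move: Aij; rewrite ij /prec eqxx.
have := pairwiseP i ls; move=> /(_ j i); rewrite !inE size_tuple => /(_ (ltn_ord _) (ltn_ord _) ji).
by rewrite -!tnth_nth Aij.
Qed.

Lemma big_OP (R : Type) (idx : R) (op : Monoid.com_law idx) (F : seq 'I_n -> R) :
  \big[op/idx]_(u in OP A) F u =
  \big[op/idx]_(s <- permutations (enum 'I_n) | lin_ext (prec A) s) F s.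
Proof.
rewrite -[RHS]big_filter -big_enum -(big_map val xpredT F); apply: perm_big.
apply: uniq_perm.
- by rewrite map_inj_uniq ?enum_uniq //; apply: val_inj.
- by rewrite filter_uniq // permutations_uniq.
move=> s; rewrite mem_filter mem_permutations; apply/mapP/andP.
  case=> u; rewrite mem_enum OP_lin_ext => /andP[uu lu] ->; split=> //.
  by apply: perm_enum_ord; rewrite ?size_tuple.
case=> ls ps; have sz : size s == n by rewrite (perm_size ps) size_enum_ord.
exists (Tuple sz) => //; rewrite mem_enum OP_lin_ext /= ls andbT.
by rewrite (perm_uniq ps) enum_uniq.
Qed.

Lemma delta_seq_asc (u : n.-tuple 'I_n) :
  delta_seq A u = asc (fun x y => (x < y) || A x y) u.
Proof.
case: n A u => [|n'] A' u; first by rewrite /delta_seq big_ord0 (tuple0 u).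
have x0 : 'I_n'.+1 := ord0.
rewrite (asc_nth _ x0) size_tuple /delta_seq big_ord_recr /= [X in _ + X]big_pred0; last first.
  by move=> j; apply/negbTE; rewrite neq_ltn ltn_ord.
rewrite addn0; apply: eq_bigr => i _.
rewrite (big_pred1 (lift ord0 i)); last by move=> j /=; rewrite -val_eqE.
rewrite /delta !(tnth_nth x0) /=.
by case: ifP.
Qed.

(** The two sides could differ only if [x] precedes [y] without an arc from [x] to [y]; an inner
    vertex of a path would then have to stand between these adjacent letters. *)
Lemma lin_ext_adjacent p q x y : perm_eq (p ++ [:: x, y & q]) (enum 'I_n) ->
  lin_ext (prec A) (p ++ [:: x, y & q]) ->
  ((x < y) || A x y) = tour x y.
Proof.
move=> ps; have sV z : z \in p ++ [:: x, y & q] by rewrite (perm_mem ps) mem_enum.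
rewrite /lin_ext pairwise_cat !allrel_consr /= => /and5P[/and3P[/allP px _ _] _].
case/andP=> nyx _ /allP yq _.
rewrite /tour nyx /=; case: (ltnP x y) => _ /=; first by rewrite orbT.
rewrite orbF; apply/idP/idP => [/arc_prec //|/andP[xy /connectP[[|z r]]]] /=.
  by move=> _ e; rewrite e eqxx in xy.
case/andP=> Axz pz ey; have czy : connect A z y by apply/connectP; exists r.
have [<- //|zy] := eqVneq z y.
have pxz := arc_prec Axz.
move: (sV z); rewrite mem_cat !inE => /or4P[/px|/eqP zx|/eqP zy'|/yq].
- by rewrite pxz.
- by rewrite zx acyclic_irr in Axz.
- by rewrite zy' eqxx in zy.
- by rewrite /prec zy czy.
Qed.

Lemma asc_tour s : perm_eq s (enum 'I_n) -> lin_ext (prec A) s ->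
  asc (fun x y => (x < y) || A x y) s = asc tour s.
Proof.
suff gen p x t : perm_eq (p ++ x :: t) (enum 'I_n) ->
    lin_ext (prec A) (p ++ x :: t) ->
    ascents (fun x y => (x < y) || A x y) x t = ascents tour x t.
  by case: s => // x t; apply: (gen [::]).
elim: t p x => //= y t IH p x ps ls; rewrite (lin_ext_adjacent ps ls).
by rewrite (IH (rcons p x)) // cat_rcons.
Qed.

Lemma card_order_preserving_bar m :
  #|order_preserving (bar A) m| = #|[set f | monotone (prec A) (m := m) f]|.
Proof.
apply: eq_card => f; rewrite !inE; apply: eq_forallb => x.
apply: eq_forallb => y; rewrite /bar connect_prec.
by case: eqVneq => [->|_] //=; rewrite leqnn implybT.
Qed.

(** * Directed triangles and the set [W] *)

Lemma W_neq0 a b c : A c a -> a < b -> b < c -> incomp A a b -> incomp A c b ->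
  W A <> set0.
Proof.
move=> ca ab bc iab icb W0; suff: [set a; b; c] \in W A by rewrite W0 in_set0.
rewrite inE; apply/existsP; exists a; apply/existsP; exists b; apply/existsP; exists c.
by rewrite eqxx ab bc ca iab icb.
Qed.

(* On a directed path from above [b] to below [b] some arc jumps over [b]. *)
Lemma W_neq0_prec a b c : prec A c a -> a < b -> b < c -> incomp A a b ->
  incomp A c b -> W A <> set0.
Proof.
case/andP=> _ /connectP[p + ->]; elim: p c => [|z p IH] c /=.
  by move=> _ ab bc; have := ltn_trans ab bc; rewrite ltnn.
case/andP=> Acz pz ab bc iab icb.
have cza : connect A z (last z p) by apply/connectP; exists p.
have pcz := arc_prec Acz.
case/andP: (iab) => nab nba; case/andP: (icb) => ncb nbc.
have zb : z != b by apply: contraNneq ncb => <-.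
have izb : incomp A z b.
  apply/andP; split; apply/negP => h.
    by move/negP: ncb; apply; apply: prec_connect_trans pcz (prec_connect h).
  by move/negP: nba; apply; apply: prec_connect_trans h cza.
case: (ltngtP z b) => [zb'|bz|/val_inj e]; last by rewrite e eqxx in zb.
  exact: (W_neq0 Acz zb' bc izb icb).
exact: IH pz ab bz iab izb.
Qed.

Lemma tour_nprec x y : tour x y -> ~~ prec A y x.
Proof. by case/orP=> [/prec_anti|/andP[]]. Qed.

(** Since [c] precedes [a], comparability of [b] with either would contradict one of the two arcs at
    [b], so both arcs come from [a < b < c]. *)
Lemma tour_prec_triangle a b c : prec A c a -> tour a b -> tour b c ->
  W A <> set0.
Proof.
move=> ca Tab Tbc; have nba := tour_nprec Tab; have ncb := tour_nprec Tbc.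
have nab : ~~ prec A a b.
  by apply: contra ncb => /prec_connect; apply: prec_connect_trans.
have nbc : ~~ prec A b c.
  by apply: contra nba => bc; apply: prec_connect_trans bc (prec_connect ca).
move: Tab Tbc; rewrite /tour (negbTE nab) (negbTE nbc) nba ncb /= => ab bc.
by apply: (W_neq0_prec ca ab bc); rewrite /incomp ?nab ?nba ?nbc ?ncb.
Qed.

(** A failure of transitivity is a directed triangle. Its arcs cannot all come from the order of the
    vertex numbers, so one lies in the poset. *)
Lemma tour_trans : W A = set0 -> transitive tour.
Proof.
move=> W0 y x z Txy Tyz; have [anti _] := tourP.
have [xz|xz] := eqVneq x z.
  have xy : y != x by apply: contraTneq Txy => ->; rewrite tour_irr.
  by move: Txy; rewrite (anti _ _ xy) xz Tyz.
apply: contraT => nTxz.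
have Tzx : tour z x by rewrite anti.
case: (boolP (prec A z x)) => zx; first by case: (tour_prec_triangle zx Txy Tyz).
case: (boolP (prec A x y)) => xy; first by case: (tour_prec_triangle xy Tyz Tzx).
case: (boolP (prec A y z)) => yz; first by case: (tour_prec_triangle yz Tzx Txy).
move: Txy Tyz Tzx; rewrite /tour (negbTE zx) (negbTE xy) (negbTE yz) /=.
by case/andP=> _ xy' /andP[_ yz'] /andP[_ zx']; lia.
Qed.

Lemma W_nb_compatible : W A <> set0 ->
  exists f : {ffun 'I_n -> 'I_3}, 1 < nb_compatible (prec A) tour f.
Proof.
move=> /eqP/set0Pn[S]; rewrite inE => /existsP[a /existsP[b /existsP[c]]].
case/and5P=> _ ab bc Aca /andP[/andP[nab nba] /andP[ncb nbc]].
have pca := arc_prec Aca.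
have bDa : b != a by rewrite -val_eqE neq_ltn ab orbT.
have bDc : b != c by rewrite -val_eqE neq_ltn bc.
(* Level 1 holds [b] and the interval from [c] to [a], whose members are incomparable to [b]; level
   0 holds what else lies below [a] or [b], level 2 the rest. *)
pose I u := connect A c u && connect A u a.
pose f := [ffun u => if (u == b) || I u then inord 1
  else if connect A u a || connect A u b then inord 0 else inord 2] : {ffun 'I_n -> 'I_3}.
have Iinc u : I u -> ~~ prec A u b && ~~ prec A b u.
  case/andP=> cu ua; apply/andP; split; apply/negP => h.
    by move/negP: ncb; apply; apply: connect_prec_trans cu h.
  by move/negP: nba; apply; apply: prec_connect_trans h ua.
have fval u : f u = (if (u == b) || I u then 1
  else if connect A u a || connect A u b then 0 else 2) :> nat.
  by rewrite ffunE; case: ifP => _; [|case: ifP => _]; rewrite inordK.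
have mf : monotone (prec A) f.
  apply/monotoneP => x y xy; rewrite !fval.
  have cxy := prec_connect xy.
  have [/orP[/eqP yb|Iy]|nSy] := boolP ((y == b) || I y).
  - rewrite yb in xy cxy; case: ifP => // _; by rewrite cxy orbT.
  - case: ifP => // _; case/andP: Iy => _ ya.
    by rewrite (connect_trans cxy ya).
  have [|nyab] := boolP (connect A y a || connect A y b); last by case: ifP => // _; case: ifP.
  move=> yab; have xab : connect A x a || connect A x b.
    by case/orP: yab => /(connect_trans cxy) ->; rewrite ?orbT.
  rewrite xab; case: ifP => // /orP[/eqP xb|Ix].
    rewrite xb in xy cxy; case/orP: yab => [ya|yb].
      by have := prec_connect_trans xy ya; rewrite (negbTE nba).
    by have := prec_connect_trans xy yb; rewrite /prec eqxx.
  case/orP: yab => [ya|yb].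
    by case/negP: nSy; rewrite /I ya (connect_trans _ cxy) ?orbT //; case/andP: Ix.
  by have /andP[] := Iinc x Ix; rewrite (prec_connect_trans xy yb).
have fb : f b = 1 :> nat by rewrite fval eqxx.
have fa : f a = f b by apply: val_inj; rewrite /= fb fval /I connect0 (prec_connect pca) orbT.
have fc : f c = f b by apply: val_inj; rewrite /= fb fval /I connect0 (prec_connect pca) orbT.
have Tbc : tour b c by rewrite /tour ncb bc orbT.
have Tab : tour a b by rewrite /tour nba ab orbT.
have inc u : f u = f b -> ~~ prec A u b && ~~ prec A b u.
  move/(congr1 val); rewrite /= fb fval; case: ifP => [|_]; last by case: ifP.
  by case/orP=> [/eqP ->|/Iinc //]; rewrite /prec eqxx.
have [s [s' [ps ps' cs cs' ss']]] := two_compatible topo_label_prec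
  tourP mf pca Tbc Tab fa fc bDa bDc inc.
by exists f; apply: nb_compatible_gt1 ps ps' cs cs' ss'.
Qed.

End Digraph.

Theorem theorem1p4 (n : nat) (A : rel 'I_n) (hn : (3 <= n)%N)
    (hA : acyclic A) :
  exists d : 'I_(n - 2) -> nat,
    Psi A - order_polynomial (bar A)
      = \sum_(i < n - 2) (d i)%:R *: xbinom i (n - 2)
    /\ ((forall i : 'I_(n - 2), d i = 0%N) <-> W A = set0).
Proof.
have V0 : (0 < #|'I_n|)%N by rewrite card_ord; apply: leq_trans hn.
have TA := tourP hA; have lA := @topo_label_prec _ _ hA.
pose L : rel 'I_n := fun x y => (topo_label A x < topo_label A y)%N.
have TL : tournament (prec A) L.
  split=> [x y xy|x y /lA //]; rewrite /L.
  have : topo_label A x != topo_label A y by rewrite (inj_eq (@topo_label_inj _ A)).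
  by case: ltngtP.
pose G T := binom_basis #|'I_n| (asc_poly (prec A) T).
have PsiE : Psi A = G (tour A).
  rewrite /Psi /G binom_basis_asc_poly // card_ord -(big_OP hA).
  apply: eq_bigr => u; rewrite OP_lin_ext // => /andP[uu lu].
  by rewrite delta_seq_asc asc_tour // perm_enum_ord ?size_tuple.
(* For a transitive tournament every monotone map is counted exactly once. *)
have GE T m : tournament (prec A) T -> irreflexive T -> transitive T ->
    (G T).[m%:R] = #|order_preserving (bar A) m|%:R.
  move=> TT Tirr Ttr; rewrite asc_poly_horner // card_order_preserving_bar.
  apply/esym/eqP; rewrite eqr_nat (sum_nb_compatible_ge lA TT m).2.
  by apply/forallP => f; apply: nb_compatible_le1.
have OmegaE : order_polynomial (bar A) = G L.
  apply/esym/order_polynomial_unique => m _; apply: GE => //.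
    by move=> x; rewrite /L ltnn.
  by move=> y x z; apply: ltn_trans.
have [h hN hE] := asc_poly_tournament (@topo_label_inj _ A) lA TA.
have n2 : (n - 2).+2 = n by lia.
(* Ascent polynomials have degree below [n], which bounds the quotient by [('X - 1)^2]. *)
have sh : (size h <= n - 2)%N.
  apply: size_sqr_multiple; rewrite -hE n2.
  apply: leq_trans (size_polyD _ _) _; rewrite size_polyN geq_max.
  by have sT T := size_asc_poly (prec A) V0 T; rewrite card_ord in sT; rewrite !sT.
have diffE : Psi A - order_polynomial (bar A) = \sum_(i < n - 2) h`_i *: xbinom i (n - 2).
  rewrite PsiE OmegaE /G -binom_basisB hE card_ord.
  by rewrite -[RHS](binom_basis_sqr sh) n2.
(* The coefficients of [h] are natural numbers, so truncation does not change them. *)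
exists (fun i => Num.truncn h`_i).
have dE : \sum_(i < n - 2) (Num.truncn h`_i)%:R *: xbinom i (n - 2)
    = \sum_(i < n - 2) h`_i *: xbinom i (n - 2).
  by apply: eq_bigr => i _; rewrite truncnK.
split; first by rewrite dE.
split=> [d0|W0 i].
  have eqPO : Psi A = order_polynomial (bar A).
    apply/eqP; rewrite -subr_eq0 diffE -dE big1 // => i _.
    by rewrite d0 scale0r.
  have [//|/eqP/(W_nb_compatible hA)[f f1]] := eqVneq (W A) set0.
  (* At 3 the map [f] is counted at least twice by [Psi A], which therefore exceeds the order
     polynomial. *)
  have := congr1 (fun p : {poly rat} => p.[3%:R]) eqPO.
  rewrite /= PsiE order_polynomialE // asc_poly_horner // card_order_preserving_bar.
  move/eqP; rewrite eqr_nat eq_sym (sum_nb_compatible_ge lA TA 3).2.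
  by move/forallP/(_ f); rewrite leqNgt f1.
(* As [tour A] is transitive, [Psi A] counts the order-preserving maps. At [n] all the binomials are
   positive, so a vanishing sum of natural multiples of them has zero coefficients. *)
have : (Psi A - order_polynomial (bar A)).[n%:R] = 0.
  rewrite hornerD hornerN order_polynomialE; last exact: leq_trans hn.
  by rewrite PsiE GE ?subrr //; [exact: tour_irr | exact: tour_trans].
rewrite diffE -dE horner_sum; under eq_bigr do rewrite hornerZ xbinomE -natrM.
rewrite -natr_sum => /eqP; rewrite pnatr_eq0 sum_nat_eq0 => /forallP/(_ i).
by rewrite /= muln_eq0 orbC -leqn0 leqNgt bin_gt0 leq_subLR; case: leqP => //; lia.
Qed.
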